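(* Let $n\ge 5$ and $2\le k<n$. Then $\operatorname{Dist}(\mathrm{PX}(n,k))=2$ and $\lceil n/k\rceil\le \rho(\mathrm{PX}(n,k))\le \lceil n/k\rceil+1$.
   Context: For integers $n\ge 3$ and $1\le k<n$, the Praeger–Xu graph $\mathrm{PX}(n,k)$ is the simple graph with vertex set $\mathbb Z_n\times\mathbb Z_2^k$; a vertex is written $(i,x)$ with $x=x_0x_1\cdots x_{k-1}$ a bitstring of length $k$. Two vertices $(i,x)$ and $(j,y)$ are adjacent if and only if (after possibly swapping the two vertices) $j=i+1$ in $\mathbb Z_n$ and $x=az_1\cdots z_{k-1}$, $y=z_1\cdots z_{k-1}b$ for some bits $a,b,z_1,\dots,z_{k-1}\in\mathbb Z_2$. For a graph $G$, $\operatorname{Dist}(G)$ is the least $d$ such that some $d$-coloring of the vertices is preserved (class-wise) only by the identity automorphism; if $\operatorname{Dist}(G)=2$, $\rho(G)$ is the minimum size of a color class over all 2-colorings preserved only by the identity automorphism. *)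

(* Defs.v *)
From mathcomp Require Import all_boot all_order all_algebra all_fingroup.

Set Implicit Arguments.
Unset Strict Implicit.
Unset Printing Implicit Defensive.

Section Distinguishing.

Variables (T : finType) (e : rel T).

Definition graph_aut (f : {perm T}) : bool :=
  [forall x, forall y, e (f x) (f y) == e x y].

Definition color_class d (c : {ffun T -> 'I_d}) (i : 'I_d) : {set T} :=
  [set x | c x == i].

Definition preserves d (c : {ffun T -> 'I_d}) (f : {perm T}) : bool :=
  [forall i, f @: color_class c i == color_class c i].

Definition distinguishing d (c : {ffun T -> 'I_d}) : bool :=
  [forall f : {perm T}, graph_aut f && preserves c f ==> (f == 1%g)].

Lemma distinguishing_ex :
  exists d, [exists c : {ffun T -> 'I_d}, distinguishing c].
Proof.
exists #|T|; apply/existsP; exists [ffun x => enum_rank x].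
apply/forallP => f; apply/implyP => /andP[_ /forallP pf].
apply/eqP/permP => x; rewrite perm1.
have /eqP/setP/(_ (f x)) := pf (enum_rank x).
rewrite imset_f ?inE ?ffunE ?eqxx // => /esym/eqP; exact: enum_rank_inj.
Qed.

Definition Dist : nat := ex_minn distinguishing_ex.

(* The default value #|T| only matters if no 2-coloring is distinguishing:
   no color class has more than #|T| elements. *)
Definition rho : nat :=
  \big[minn/#|T|]_(c : {ffun T -> 'I_2} | distinguishing c)
    \big[minn/#|T|]_(i < 2) #|color_class c i|.

End Distinguishing.

Section PraegerXu.

Variables n k : nat.

Definition PX_vertex : finType := ('I_n * k.-tuple bool)%type.

(* ordS is the successor i + 1 modulo n. *)
Definition PX_arc (u v : PX_vertex) : bool :=
  (v.1 == ordS u.1) &&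
  [exists a : bool, exists b : bool, exists z : k.-1.-tuple bool,
     (u.2 == a :: z :> seq bool) && (v.2 == rcons z b :> seq bool)].

Definition PX : rel PX_vertex := fun u v => PX_arc u v || PX_arc v u.

Lemma PX_sym : symmetric PX.
Proof. by move=> u v; rewrite /PX orbC. Qed.

Lemma PX_irrefl : 1 < n -> irreflexive PX.
Proof.
move=> n_gt1 [i x]; rewrite /PX orbb /PX_arc /=.
case: eqP => //= /(congr1 val) /= iE; exfalso; move: iE.
have := ltn_ord i; rewrite leq_eqVlt => /orP[/eqP iE | iLt].
  by rewrite [in i.+1]iE modnn => i0; move: iE n_gt1; rewrite i0 => <-.
by rewrite modn_small // => /eqP; rewrite -[X in X == _]addn0 -addn1 eqn_add2l.
Qed.

End PraegerXu.

Arguments PX n k : clear implicits.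

(* Main.v *)
(* Call an edge from fibre i to fibre i + 1 an arc, and read bit t of a vertex
   in fibre i as sitting at position i + t of Z_n. Flipping the bit at one fixed
   position is an automorphism, so the vertices of a color class must together
   see all n positions, k at a time: this is the lower bound, and it excludes
   fewer than two colors.

   For the upper bound, two neighbors of v have a second common neighbor iff
   they lie on the same side of v, so by connectivity an automorphism preserves
   all arcs or reverses all arcs. One that preserves the arcs shifts the fibres,
   and the new bit at a position depends only on the position and the old bit;
   hence it is determined by its values on any set seeing all positions. The
   class is one vertex in each of the fibres 1 and 0, k, 2k, ..., all zero except
   for 1...10 in fibre k. The arc from fibre 0 to fibre 1 is the only one inside
   it, up to a possible arc from n - 1 to 0, onto which divisibility by k keeps it
   from being mapped; so fibres 0 and 1 are fixed or swapped. A swap would force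
   k | n + 1 and reverse the path of length k - 1 from fibre n + 1 - k to fibre 0,
   but the vertices in fibres 1 and k disagree at position k. *)

Require Import Defs.
From mathcomp Require Import all_boot all_order all_algebra all_fingroup.
From mathcomp Require Import zify.

Set Implicit Arguments.
Unset Strict Implicit.
Unset Printing Implicit Defensive.

Lemma val_ordS (n : nat) (i : 'I_n) :
  ordS i = (if i.+1 == n then 0 else i.+1) :> nat.
Proof.
rewrite /=; case: eqP => [->|/eqP ne]; first by rewrite modnn.
by rewrite modn_small // ltn_neqAle ne ltn_ord.
Qed.

Lemma eqmod_small (n a b : nat) : a < n -> b < n -> a = b %[mod n] -> a = b.
Proof. by move=> an bn; rewrite !modn_small. Qed.

Lemma dvdn_consec (d m : nat) : 1 < d -> d %| m -> d %| m.+1 -> False.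
Proof. by move=> d_gt1 dm; rewrite -addn1 dvdn_addr // dvdn1; lia. Qed.

Lemma ord2_eq (a b i : 'I_2) : a != i -> b != i -> a = b.
Proof.
by case: a b i => [[|[|?]] ?] [[|[|?]] ?] [[|[|?]] ?] // _ _; apply/ord_inj.
Qed.

Lemma preserves_color (T : finType) d (c : {ffun T -> 'I_d}) (f : {perm T}) :
  (forall x, c (f x) = c x) -> preserves c f.
Proof.
move=> cf; apply/forallP => i; rewrite eqEcard card_imset ?leqnn ?andbT.
  by apply/subsetP => _ /imsetP[x + ->]; rewrite !inE cf.
exact: perm_inj.
Qed.

Section Graph.

Variables n k : nat.
Hypotheses (n_ge5 : 5 <= n) (k_ge2 : 2 <= k).
Local Notation V := (PX_vertex n k).
Implicit Types (u v w : V) (t : nat).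

Let n_gt0 : 0 < n. Proof. by lia. Qed.

(** * Vertices as windows of bits, and paths along arcs *)

Definition bit (u : V) (t : nat) : bool := nth false u.2 t.

Definition vertex (i : 'I_n) (F : nat -> bool) : V := (i, [tuple F t | t < k]).

Lemma bit_vertex i F t : t < k -> bit (vertex i F) t = F t.
Proof. by move=> tk; exact: (nth_mktuple _ _ (Ordinal tk)). Qed.

Lemma bit_default u t : k <= t -> bit u t = false.
Proof. by move=> kt; rewrite /bit nth_default // size_tuple. Qed.

Lemma vertex_ext u v :
  u.1 = v.1 :> nat -> (forall t, t < k -> bit u t = bit v t) -> u = v.
Proof.
case: u v => [i x] [j y] /= /val_inj -> xy; congr pair.
apply/val_inj/(@eq_from_nth _ false); first by rewrite !size_tuple.
by move=> t; rewrite size_tuple => /xy.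
Qed.

Lemma arcP u v :
  reflect (v.1 = ordS u.1 /\ forall t, t.+1 < k -> bit u t.+1 = bit v t)
          (PX_arc u v).
Proof.
apply: (iffP andP) => [[/eqP-> /existsP[a /existsP[b /existsP[z /andP[]]]]]|].
  move=> /eqP ux /eqP vx; split=> // t tk.
  rewrite /bit ux vx /= nth_rcons size_tuple.
  by rewrite (_ : t < k.-1) //; lia.
move=> [-> uv]; split=> //.
apply/existsP; exists (bit u 0); apply/existsP; exists (bit v k.-1).
have [z nthz] : exists z : k.-1.-tuple bool,
    forall t, t < k.-1 -> nth false z t = bit u t.+1.
  exists [tuple bit u t.+1 | t < k.-1] => t tk.
  exact: (nth_mktuple _ _ (Ordinal tk)).
apply/existsP; exists z.
apply/andP; split; apply/eqP/(@eq_from_nth _ false).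
- by rewrite /= !size_tuple prednK // ltnW.
- by case=> [|t]; rewrite size_tuple => tk //=; rewrite nthz //; lia.
- by rewrite size_rcons !size_tuple prednK // ltnW.
- move=> t; rewrite size_tuple => tk; rewrite nth_rcons size_tuple.
  case: ltnP => tk'; first by rewrite nthz // uv //; lia.
  by rewrite (_ : t = k.-1) ?eqxx //; lia.
Qed.

Lemma arc_fst u v : PX_arc u v -> v.1 = ordS u.1.
Proof. by case/arcP. Qed.

Lemma arc_val u v :
  PX_arc u v -> v.1 = u.1.+1 :> nat \/ u.1.+1 = n /\ v.1 = 0 :> nat.
Proof. by move=> /arc_fst ->; rewrite val_ordS; case: eqP; [right|left]. Qed.

Lemma arc_bit u v t : PX_arc u v -> t.+1 < k -> bit u t.+1 = bit v t.
Proof. by case/arcP => _; apply. Qed.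

Lemma arc_asym u v : PX_arc u v -> PX_arc v u = false.
Proof.
by move=> /arc_val uv; apply/negP => /arc_val vu; have := ltn_ord u.1; lia.
Qed.

(* The bit that enters is 0. *)
Definition up (u : V) : V := vertex (ordS u.1) (fun t => bit u t.+1).

Definition down (u : V) : V :=
  vertex (ord_pred u.1) (fun t => if t is t'.+1 then bit u t' else false).

Lemma arc_up u : PX_arc u (up u).
Proof. by apply/arcP; split=> // t tk; rewrite bit_vertex //; lia. Qed.

Lemma arc_down u : PX_arc (down u) u.
Proof. by apply/arcP; split=> [|t tk]; rewrite /= ?ord_predK // bit_vertex. Qed.

(** No bound on [t] is needed: past the end [bit] defaults to false, which matches the zeros that
    [up] shifts in. *)
Lemma bit_iter_up m u t : bit (iter m up u) t = bit u (t + m).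
Proof.
elim: m t => [|m IH] t; first by rewrite addn0.
rewrite iterS; case: (ltnP t k) => tk.
  by rewrite bit_vertex // IH addSnnS.
by rewrite !bit_default //; lia.
Qed.

Lemma fst_iter_up m u : (iter m up u).1 = (u.1 + m) %% n :> nat.
Proof.
elim: m => [|m IH]; first by rewrite addn0 modn_small.
by rewrite iterS /= IH -addn1 modnDml addn1 addnS.
Qed.

Lemma fst_iter_down m u v : u.1 = v.1 -> (iter m down u).1 = (iter m down v).1.
Proof. by move=> uv; elim: m => //= m ->. Qed.

Lemma bit_iter_down m u t : t < k ->
  bit (iter m down u) t = if t < m then false else bit u (t - m).
Proof.
elim: m t => [|m IH] t tk; first by rewrite ltn0 subn0.
rewrite iterS bit_vertex //; case: t tk => [|t] tk //.
by rewrite IH ?subSS //; lia.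
Qed.

Definition root : V := vertex (Ordinal n_gt0) (fun=> false).

Lemma iter_up_root u : exists m, iter m up u = root.
Proof.
(* [n - u.1] steps lead to fibre 0; [n] more turns for each of the [k] bits would overwrite
   everything, and a multiple of [n] keeps the fibre. *)
exists (n * k + (n - u.1)); apply: vertex_ext => [|t tk].
  by rewrite fst_iter_up addnCA mulnC modnMDl subnKC ?modnn // ltnW.
by rewrite bit_iter_up bit_vertex // bit_default //; nia.
Qed.

(** This is connectivity in the form used below: [up] leads from every vertex to [root]. *)
Lemma PX_const (A : Type) (F : V -> A) :
  (forall u v, PX_arc u v -> F u = F v) -> forall u v, F u = F v.
Proof.
move=> FE; suff FE0 u : F u = F root by move=> u v; rewrite !FE0.
by have [m <-] := iter_up_root u; elim: m => //= m ->; apply/FE/arc_up.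
Qed.

(* A common neighbor of the ends of a path w -> v -> u lies in the fibre of v,
   as n does not divide 4; it shares with v all bits but the first because of u,
   and all bits but the last because of w. *)
Lemma PX_side u v w : PX n k v u -> PX n k v w -> u != w ->
  (PX_arc v u == PX_arc v w) =
  [exists v', [&& v' != v, PX n k v' u & PX n k v' w]].
Proof.
have opp v1 u1 w1 : PX_arc v1 u1 -> PX_arc w1 v1 ->
    forall v', PX n k v' u1 -> PX n k v' w1 -> v' = v1.
  move=> vu wv v'.
  have lt_v := ltn_ord v1.1; have lt_u := ltn_ord u1.1.
  have lt_w := ltn_ord w1.1; have lt_v' := ltn_ord v'.1.
  have e1 := arc_val vu; have e2 := arc_val wv.
  case/orP => vu'; case/orP => wv';
    have e3 := arc_val vu'; have e4 := arc_val wv'; try lia.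
  apply: vertex_ext => [|[|t] tk].
  - lia.
  - by rewrite -(arc_bit wv) // -(arc_bit wv').
  - by rewrite (arc_bit vu) // (arc_bit vu').
move=> vu vw uw; apply/eqP/existsP; last first.
  move=> [v' /and3P[/eqP nv v'u v'w]].
  case/orP: vu => vu; case/orP: vw => vw.
  - by rewrite vu vw.
  - by case: nv; apply: opp vu vw _ v'u v'w.
  - by case: nv; apply: opp vw vu _ v'w v'u.
  - by rewrite (arc_asym vu) (arc_asym vw).
move=> uvw.
(* An arc out of [v] forgets the first bit of [v], an arc into [v] its last bit; flipping the
   forgotten bit gives the second common neighbor. *)
pose flip t0 := vertex v.1 (fun t => bit v t (+) (t == t0)).
have flip_neq t0 : t0 < k -> flip t0 != v.
  move=> t0k; apply/eqP => /(congr1 (bit^~ t0)).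
  by rewrite bit_vertex // eqxx; case: bit.
case/orP: (vu) (vw) => [arc_vu _|arc_uv].
  have := uvw; rewrite arc_vu => /esym arc_vw.
  exists (flip 0); rewrite flip_neq ?(ltnW k_ge2) //=.
  apply/andP; split; apply/orP; left; apply/arcP;
    (split=> [|t tk];
       first by [exact: (arc_fst arc_vu) | exact: (arc_fst arc_vw)]);
    by rewrite bit_vertex // addbF; apply: arc_bit.
case/orP=> [arc_vw|arc_wv]; first by rewrite arc_vw (arc_asym arc_uv) in uvw.
exists (flip k.-1); rewrite flip_neq ?prednK ?(ltnW k_ge2) //=.
have flipE t : t.+1 < k -> bit (flip k.-1) t = bit v t.
  move=> tk; rewrite bit_vertex ?(ltnW tk) //.
  by rewrite (_ : t == k.-1 = false) ?addbF //; lia.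
apply/andP; split; apply/orP; right; apply/arcP;
  (split=> [|t tk];
     first by [exact: (arc_fst arc_uv) | exact: (arc_fst arc_wv)]);
  by rewrite flipE //; apply: arc_bit.
Qed.

(** * Automorphisms preserve all arcs or reverse all arcs *)

Lemma autE (f : {perm V}) : graph_aut (PX n k) f ->
  forall u v, PX n k (f u) (f v) = PX n k u v.
Proof. by move=> /forallP fa u v; apply/eqP/(forallP (fa u)). Qed.

(** Having a second common neighbor is invariant under automorphisms, so by [PX_side] two edges at
    [v] are both kept in direction or both reversed. *)
Lemma aut_side (f : {perm V}) u v w : graph_aut (PX n k) f ->
    PX n k v u -> PX n k v w ->
  (PX_arc v u == PX_arc (f v) (f u)) = (PX_arc v w == PX_arc (f v) (f w)).
Proof.
move=> /autE fE vu vw; case: (eqVneq u w) => [-> //|uw].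
suff: (PX_arc v u == PX_arc v w) = (PX_arc (f v) (f u) == PX_arc (f v) (f w)).
  by do 4 case: PX_arc.
rewrite !PX_side ?fE ?(inj_eq perm_inj) //.
apply/existsP/existsP=> -[v' v'P].
  by exists (f v'); rewrite !fE (inj_eq perm_inj).
exists (f^-1%g v').
by rewrite -(fE _ u) -(fE _ w) -(inj_eq (@perm_inj _ f)) permKV.
Qed.

Lemma aut_arc (f : {perm V}) : graph_aut (PX n k) f ->
  (forall u v, PX_arc (f u) (f v) = PX_arc u v) \/
  (forall u v, PX_arc (f u) (f v) = PX_arc v u).
Proof.
move=> fa; pose o u v := PX_arc u v == PX_arc (f u) (f v).
have o_sym u v : PX n k u v -> o u v = o v u.
  move=> uv; have := uv; rewrite -(autE fa) /o.
  by case/orP: uv => uv; case/orP => fuv;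
    rewrite ?uv ?fuv ?(arc_asym uv) ?(arc_asym fuv).
(* Along an arc from [u] to [v], the edges from [u] to [up u], from [u] to [v] and from [v] to
   [up v] successively share an end. *)
have o_const u v : o u (up u) = o v (up v).
  apply: (@PX_const _ (fun u => o u (up u))) => {}u {}v uv.
  have PXup w : PX n k w (up w) by rewrite /PX arc_up.
  have PXuv : PX n k u v by rewrite /PX uv.
  rewrite /o (aut_side fa (PXup u) PXuv) -/(o u v) o_sym //.
  by apply: aut_side => //; rewrite PX_sym.
have o_arc u v w : PX n k u v -> o u v = o w (up w).
  move=> uv; rewrite (o_const w u); apply: aut_side => //.
  by rewrite /PX arc_up.
case: (boolP (o root (up root))) => o0; [left|right];
  move=> u v; have := autE fa u v; case: (boolP (PX n k u v)) => uv fuv.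
- by have := o_arc _ _ root uv; rewrite o0 => /eqP.
- by move/norP: uv fuv => [/negbTE-> _] /norP[/negbTE-> _].
- have := o_arc _ _ root uv; rewrite (negbTE o0) /o.
  by case/orP: uv fuv => uv /orP[] fuv;
    rewrite ?uv ?fuv ?(arc_asym uv) ?(arc_asym fuv).
- by move/norP: uv fuv => [_ /negbTE->] /norP[/negbTE-> _].
Qed.

(** * Effect of arc-preserving and arc-reversing maps on bits and fibres *)

Lemma arc_hom_up (f : V -> V) m u t :
    (forall u v, PX_arc u v -> PX_arc (f u) (f v)) ->
  t + m < k -> bit (f (iter m up u)) t = bit (f u) (t + m).
Proof.
move=> fE; elim: m t => [|m IH] t tm; first by rewrite addn0.
by rewrite iterS -(arc_bit (fE _ _ (arc_up _))) ?IH ?addSnnS //; lia.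
Qed.

Lemma arc_hom_down (f : V -> V) m u t :
    (forall u v, PX_arc u v -> PX_arc (f u) (f v)) ->
  t + m < k -> bit (f (iter m down u)) (t + m) = bit (f u) t.
Proof.
move=> fE; elim: m => [|m IH] tm; first by rewrite addn0.
by rewrite iterS addnS (arc_bit (fE _ _ (arc_down _))) ?IH //; lia.
Qed.

Lemma arc_antihom_up (f : V -> V) m u t :
    (forall u v, PX_arc u v -> PX_arc (f v) (f u)) ->
  t + m < k -> bit (f (iter m up u)) (t + m) = bit (f u) t.
Proof.
move=> fE; elim: m => [|m IH] tm; first by rewrite addn0.
by rewrite iterS addnS (arc_bit (fE _ _ (arc_up _))) ?IH //; lia.
Qed.

(** A walk of [m] steps up from [u] to [root] raises the fibre by [m] modulo [n] both before and
    after applying [f]. *)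
Lemma arc_hom_fst (f : V -> V) u :
    (forall u v, PX_arc u v -> PX_arc (f u) (f v)) ->
  (f u).1 = (f root).1 + u.1 %[mod n].
Proof.
move=> fE; have [m um] := iter_up_root u.
have := fst_iter_up m u; rewrite um /= => um0.
have e : (f root).1 = (f u).1 + m %[mod n].
  rewrite -um; elim: m {um um0} => [|m IH]; first by rewrite addn0.
  rewrite iterS (arc_fst (fE _ _ (arc_up _))) /= modn_mod -addn1.
  by rewrite -modnDml IH modnDml -addnA addn1.
by rewrite -modnDml e modnDml -addnA (addnC m) -modnDmr -um0 addn0.
Qed.

Lemma arc_antihom_fst (f : V -> V) u :
    (forall u v, PX_arc u v -> PX_arc (f v) (f u)) ->
  (f u).1 + u.1 = (f root).1 %[mod n].
Proof.
move=> fE; have [m um] := iter_up_root u.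
have := fst_iter_up m u; rewrite um /= => um0.
have e : (f root).1 + m = (f u).1 %[mod n].
  rewrite -um; elim: m {um um0} => [|m IH]; first by rewrite addn0.
  rewrite -IH (arc_fst (fE _ _ (arc_up (iter m up u)))) /=.
  by rewrite modnDml addnS.
by rewrite -modnDml -e modnDml -addnA (addnC m) -modnDmr -um0 addn0.
Qed.

(* Both walks end at the same vertex: up to the fibre of the position, where
   the common bit comes first, then down [k - 1] times, which overwrites every
   other bit by 0. *)
Lemma arc_hom_bit (f : V -> V) u v t t' :
    (forall u v, PX_arc u v -> PX_arc (f u) (f v)) ->
    t < k -> t' < k -> u.1 + t = v.1 + t' %[mod n] ->
  bit u t = bit v t' -> bit (f u) t = bit (f v) t'.
Proof.
move=> fE tk t'k ut bt.
have to0 w s : s < k ->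
    bit (f w) s = bit (f (iter k.-1 down (iter s up w))) k.-1.
  move=> sk; rewrite -[k.-1 in RHS]add0n arc_hom_down ?prednK ?(ltnW k_ge2) //.
  by rewrite arc_hom_up.
rewrite (to0 _ _ tk) (to0 _ _ t'k); congr (bit (f _) _).
apply: vertex_ext => [|s sk].
  congr nat_of_ord; apply/fst_iter_down/ord_inj.
  by rewrite !fst_iter_up.
rewrite !bit_iter_down //; case: ltnP => // ks.
by rewrite !bit_iter_up (_ : s - k.-1 = 0) //; lia.
Qed.

Lemma arc_perm_eq1 (f : {perm V}) (A : {set V}) :
    (forall u v, PX_arc (f u) (f v) = PX_arc u v) ->
    (forall u, (f u).1 = u.1) ->
    (forall u, u \in A -> f u = u) ->
    (forall j, j < n -> exists2 s, s \in A & exists2 t, t < k & s.1 + t = j) ->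
  f = 1%g.
Proof.
move=> fE f1 fA Acov; apply/permP => u; rewrite perm1.
apply: vertex_ext => [|t tk]; first by rewrite f1.
have [s sA [t' t'k sj]] := Acov ((u.1 + t) %% n) (ltn_pmod _ n_gt0).
have ut : u.1 + t = s.1 + t' %[mod n] by rewrite sj modn_mod.
(* Agreement with the fixed bit of [s] is carried forward by [f] and, in [h2], back by its inverse;
   for booleans the resulting equivalence forces equality. *)
have h1 : bit u t = bit s t' -> bit (f u) t = bit s t'.
  move=> bt; rewrite -[in RHS](fA s sA).
  by apply: (arc_hom_bit (f := f)) => // v w; rewrite fE.
have h2 : bit (f u) t = bit s t' -> bit u t = bit s t'.
  move=> bt; rewrite -[u](permK f) -[s](permK f).
  apply: (arc_hom_bit (f := f^-1%g)) => // [v w||].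
  - by rewrite -(fE (f^-1%g v)) !permKV.
  - by rewrite !f1.
  - by rewrite (fA s sA).
by move: h1 h2; do 3 case: bit => //; intuition.
Qed.

Hypothesis k_lt_n : k < n.

(** * The color class for the upper bound *)

Definition in_fibres (i : nat) : bool := (i == 1) || (k %| i).

Definition seed (i : 'I_n) : V :=
  vertex i (fun t => (i == k :> nat) && (t < k.-1)).

Definition seeds : {set V} := [set u : V | in_fibres u.1 && (u == seed u.1)].

Lemma seed_in (i : 'I_n) : in_fibres i -> seed i \in seeds.
Proof. by rewrite inE /= eqxx andbT. Qed.

Lemma seeds_fibre u : u \in seeds -> in_fibres u.1.
Proof. by rewrite inE => /andP[]. Qed.

Lemma seeds_bit u t : u \in seeds ->
  bit u t = (u.1 == k :> nat) && (t < k.-1).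
Proof.
rewrite inE => /andP[_ /eqP ->] /=; case: (ltnP t k) => tk.
  by rewrite bit_vertex.
by rewrite bit_default // (_ : t < k.-1 = false) ?andbF //; lia.
Qed.

Lemma seeds_inj u v : u \in seeds -> v \in seeds -> u.1 = v.1 :> nat -> u = v.
Proof.
move=> uS vS uv; apply: vertex_ext => // t _.
by rewrite !seeds_bit // uv.
Qed.

Lemma card_seeds : #|seeds| <= (n.-1 %/ k).+2.
Proof.
pose r := 1 :: [seq j * k | j <- iota 0 (n.-1 %/ k).+1].
have -> : (n.-1 %/ k).+2 = size r by rewrite /= size_map size_iota.
rewrite cardE -(size_map (fun u : V => nat_of_ord u.1)); apply: uniq_leq_size.
  rewrite map_inj_in_uniq ?enum_uniq // => u v.
  by rewrite !mem_enum; apply: seeds_inj.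
move=> i /mapP[u]; rewrite mem_enum => /seeds_fibre + ->; rewrite inE.
case/orP=> [-> //|/dvdnP[j uj]]; apply/orP; right; apply/mapP; exists j => //.
rewrite mem_iota add0n ltnS /= leq_divRL ?(ltnW k_ge2) // -uj.
by have := ltn_ord u.1; lia.
Qed.

Lemma seeds_cover j : j < n ->
  exists2 s, s \in seeds & exists2 t, t < k & s.1 + t = j.
Proof.
move=> jn; have i_lt : j %/ k * k < n.
  exact: leq_ltn_trans (leq_trunc_div _ _) jn.
exists (seed (Ordinal i_lt)).
  by apply: seed_in; rewrite /in_fibres dvdn_mull ?orbT.
by exists (j %% k); rewrite ?ltn_mod ?(ltnW k_ge2) //= -divn_eq.
Qed.

Lemma seeds_arc u v : PX_arc u v -> u \in seeds -> v \in seeds ->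
  u.1 = 0 :> nat /\ v.1 = 1 :> nat \/
  [/\ u.1 = n.-1 :> nat, v.1 = 0 :> nat, k %| n.-1 & k < n.-1].
Proof.
move=> uv uS vS; have := arc_bit uv k_ge2.
rewrite !seeds_bit //; have := seeds_fibre uS; have := seeds_fibre vS.
have := ltn_ord u.1; rewrite /in_fibres.
case: (arc_val uv) => [->|[un ->]] u_lt.
  case/orP=> [/eqP [->]|kv]; first by left.
  case/orP=> [/eqP u1|ku].
    (* An arc from fibre 1 to fibre 2 needs [k = 2]; the member in fibre 2 is then 10, and the bits
       at position 2 disagree. *)
    have k2 : k = 2 by apply/eqP; rewrite eqn_leq k_ge2 dvdn_leq // -u1.
    by rewrite u1; lia.
  by move: kv; rewrite -addn1 dvdn_addr // dvdn1; lia.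
move=> _ /orP[/eqP u1|]; first by lia.
have -> : u.1 = n.-1 :> nat by lia.
(* If [k = n.-1], then [k >= 4], so bit 1 of the member in fibre [k] is 1, against the zeros in
   fibre 0. *)
move=> kn b; right; split=> //.
by lia.
Qed.

Lemma seeds_rigid (f : {perm V}) : graph_aut (PX n k) f ->
  (forall u, u \in seeds -> f u \in seeds) -> f = 1%g.
Proof.
move=> fa fS.
have n_gt1 : 1 < n by lia.
pose s0 := seed (Ordinal n_gt0); pose s1 := seed (Ordinal n_gt1).
pose sk := seed (Ordinal k_lt_n).
have s0S : s0 \in seeds by apply: seed_in; rewrite /in_fibres dvdn0.
have s1S : s1 \in seeds by apply: seed_in.
have skS : sk \in seeds by apply: seed_in; rewrite /in_fibres dvdnn orbT.
have s01 : PX_arc s0 s1.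
  apply/arcP; split=> [|t tk].
    by apply/ord_inj; rewrite val_ordS; case: eqP => /=; lia.
  by rewrite !seeds_bit //=; lia.
have s0E : s0 = root.
  by apply: vertex_ext => // t tk; rewrite seeds_bit // bit_vertex //=; lia.
have f1_lt u := ltn_ord (f u).1.
case: (aut_arc fa) => fE.
  have fst u : (f u).1 = (f s0).1 + u.1 %[mod n].
    by rewrite s0E; apply: (arc_hom_fst (f := f)) => v w; rewrite fE.
  have fs01 : PX_arc (f s0) (f s1) by rewrite fE.
  case: (seeds_arc fs01 (fS _ s0S) (fS _ s1S)) => [[f0 _]|[f0 _ kn k_lt]].
    have f1 u : (f u).1 = u.1.
      by apply/ord_inj/eqmod_small => //; rewrite fst f0.
    apply: (arc_perm_eq1 (A := seeds)) => // [u uS|]; last exact: seeds_cover.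
    by apply: seeds_inj => //; [apply: fS | rewrite f1].
  (* Here [f] lowers every fibre by 1, so fibre [n.-1] goes to [n.-2], and [k] would divide both. *)
  have n1_lt : n.-1 < n by lia.
  pose s := seed (Ordinal n1_lt).
  have sS : s \in seeds by apply: seed_in; rewrite /in_fibres /= kn orbT.
  have fs : (f s).1 = n.-2 :> nat.
    apply: eqmod_small; rewrite ?f1_lt //; first by lia.
    rewrite fst f0 /= (_ : n.-1 + n.-1 = n.-2 + n) ?modnDr //; lia.
  have := seeds_fibre (fS _ sS); rewrite fs => /orP[/eqP|k2]; first by lia.
  by case: (dvdn_consec k_ge2 k2); rewrite (_ : n.-2.+1 = n.-1) //; lia.
have fst u : (f u).1 + u.1 = (f s0).1 %[mod n].
  by rewrite s0E; apply: (arc_antihom_fst (f := f)) => v w; rewrite fE.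
have fs10 : PX_arc (f s1) (f s0) by rewrite fE.
case: (seeds_arc fs10 (fS _ s1S) (fS _ s0S)) => [[f1 f0]|[_ f0 kn k_lt]].
  have fk : (f sk).1 = n.+1 - k :> nat.
    apply: eqmod_small; rewrite ?f1_lt //; first by lia.
    apply/eqP; rewrite -(eqn_modDr k); apply/eqP.
    rewrite (fst sk) f0 (_ : n.+1 - k + k = 1 + n) ?modnDr //; lia.
  have := seeds_fibre (fS _ skS); rewrite fk => /orP[/eqP|kn]; first by lia.
  have i_lt : n.+1 - k < n by lia.
  pose s := seed (Ordinal i_lt).
  have sS : s \in seeds by apply: seed_in; rewrite /in_fibres /= kn orbT.
  (* Only the last bit of [s] survives, and it is 0 even if [s] lies in fibre [k]. *)
  have s_s0 : iter k.-1 up s = s0.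
    apply: vertex_ext => [|t tk].
      by rewrite fst_iter_up /= (_ : _ + _ = n) ?modnn //; lia.
    rewrite bit_iter_up !seeds_bit //=.
    by rewrite (_ : t + k.-1 < k.-1 = false) ?andbF //; lia.
  have fs : (f s).1 = k :> nat.
    apply: eqmod_small; rewrite ?f1_lt //.
    apply/eqP; rewrite -(eqn_modDr (n.+1 - k)); apply/eqP.
    rewrite (fst s) f0 (_ : k + (n.+1 - k) = 1 + n) ?modnDr //; lia.
  (* Both bits sit at position [k]: the left one belongs to the member in fibre 1 and is 0, the
     right one to the member in fibre [k] and is 1. *)
  have : bit (f (iter k.-1 up s)) (0 + k.-1) = bit (f s) 0.
    by apply: (arc_antihom_up (f := f)) => [v w|]; [rewrite fE | lia].
  by rewrite s_s0 !seeds_bit ?fS // fs f0 eqxx /=; lia.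
(* Here [f] negates the fibres, so [k] would divide [n - k], hence [n], as well as [n.-1]. *)
have fk : (f sk).1 = n - k :> nat.
  apply: eqmod_small; rewrite ?f1_lt //; first by lia.
  apply/eqP; rewrite -(eqn_modDr k); apply/eqP.
  rewrite (fst sk) f0 subnK ?modnn ?mod0n // ltnW //.
have := seeds_fibre (fS _ skS); rewrite fk => /orP[/eqP|kn']; first by lia.
case: (dvdn_consec k_ge2 kn); rewrite prednK //.
by rewrite -(subnK (ltnW k_lt_n)) dvdn_addr.
Qed.

(** * Flipping one position, and the lower bound *)

Definition flip (j : nat) (u : V) : V :=
  vertex u.1 (fun t => bit u t (+) ((u.1 + t) %% n == j)).

Lemma flipK j : involutive (flip j).
Proof.
by move=> u; apply: vertex_ext => // t tk; rewrite !bit_vertex // addbK.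
Qed.

Lemma flip_id j u :
  (forall t, t < k -> (u.1 + t) %% n != j) -> flip j u = u.
Proof.
move=> uj; apply: vertex_ext => // t tk.
by rewrite bit_vertex // (negbTE (uj t tk)) addbF.
Qed.

Lemma flip_arc j u v : PX_arc (flip j u) (flip j v) = PX_arc u v.
Proof.
have hom x y : PX_arc x y -> PX_arc (flip j x) (flip j y).
  move=> xy; apply/arcP; split=> [|t tk]; first exact: arc_fst xy.
  rewrite !bit_vertex ?(ltnW tk) // (arc_bit xy tk) (arc_fst xy) /=.
  by rewrite modnDml addSnnS.
by apply/idP/idP => [/hom|]; [rewrite !flipK | apply: hom].
Qed.

Definition flip_perm (j : nat) : {perm V} := perm (inv_inj (flipK j)).

Lemma flip_perm_aut j : graph_aut (PX n k) (flip_perm j).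
Proof.
apply/forallP => u; apply/forallP => v.
by rewrite /PX !permE !flip_arc.
Qed.

Lemma flip_perm_neq1 j : j < n -> flip_perm j != 1%g.
Proof.
move=> jn; apply/eqP => /permP/(_ (vertex (Ordinal jn) (fun=> false))).
rewrite permE perm1 => /(congr1 (fun u => bit u 0)).
by rewrite !bit_vertex ?(ltnW k_ge2) //= addn0 modn_small // eqxx.
Qed.

Lemma distinguishing_flip d (c : {ffun V -> 'I_d}) j : j < n ->
  distinguishing (PX n k) c -> exists u, c (flip j u) != c u.
Proof.
move=> jn /forallP/(_ (flip_perm j)); rewrite flip_perm_aut /= => dc.
apply/existsP; apply: contraNT (flip_perm_neq1 jn) => /existsPn cE.
apply: (implyP dc); apply: preserves_color => u; rewrite permE.
by apply/eqP; rewrite -[_ == _]negbK cE.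
Qed.

Lemma distinguishing_ge2 d (c : {ffun V -> 'I_d}) :
  distinguishing (PX n k) c -> 2 <= d.
Proof.
case: d c => [|[|//]] c; first by case: (c root).
by move=> /(distinguishing_flip n_gt0)[u]; rewrite !ord1.
Qed.

(** Were the class smaller, some position would be seen by none of its vertices. Flipping there
    fixes the class pointwise, so with two colors it changes no color. *)
Lemma color_class_ge (c : {ffun V -> 'I_2}) i :
  distinguishing (PX n k) c -> n <= #|color_class c i| * k.
Proof.
move=> dc; rewrite leqNgt; apply/negP => small.
pose A := color_class c i.
pose pos (p : V * 'I_k) := Ordinal (ltn_pmod (p.1.1 + p.2) n_gt0).
pose P := pos @: setX A [set: 'I_k].
have /set0Pn[j] : ~: P != set0.
  rewrite -card_gt0 cardsCs setCK subn_gt0 card_ord; apply: leq_ltn_trans small.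
  by apply: leq_trans (leq_imset_card _ _) _; rewrite cardsX cardsT card_ord.
rewrite inE => jP; have flipA u : u \in A -> flip j u = u.
  move=> uA; apply: flip_id => t tk; apply: contra jP => /eqP tj.
  apply/imsetP; exists (u, Ordinal tk); first by rewrite in_setX /= uA in_setT.
  exact/ord_inj/esym.
have [u] := distinguishing_flip (ltn_ord j) dc.
case: (boolP (u \in A)) => [/flipA ->|uA]; first by rewrite eqxx.
case: (boolP (flip j u \in A)) => [/flipA|fA].
  by rewrite flipK => <-; rewrite eqxx.
by rewrite !inE in uA fA; case/eqP; apply: ord2_eq fA uA.
Qed.

Lemma seeds_distinguishing :
  exists2 c : {ffun V -> 'I_2}, distinguishing (PX n k) c &
    color_class c ord0 = seeds.
Proof.
pose c : {ffun V -> 'I_2} := [ffun u => if u \in seeds then ord0 else ord_max].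
have c0 : color_class c ord0 = seeds.
  by apply/setP => u; rewrite inE ffunE; case: ifP.
exists c => //; apply/forallP => f; apply/implyP => /andP[fa /forallP/(_ ord0)].
rewrite c0 => /eqP fS; apply/eqP/seeds_rigid => // u uS.
by rewrite -fS imset_f.
Qed.

End Graph.

(** * The ceiling and the two bounds on [rho] *)

Import GRing.Theory Num.Theory.
Local Open Scope ring_scope.

Lemma ceil_natdiv (n k : nat) : (0 < n)%N -> (0 < k)%N ->
  Num.ceil (n%:R / k%:R : rat) = ((n.-1 %/ k).+1)%:Z.
Proof.
move=> n_gt0 k_gt0; apply: ceil_def.
rewrite -[in X in (X - 1)]addn1 PoszD addrK -!pmulrn.
rewrite ltr_pdivlMr ?ltr0n //.
rewrite ler_pdivrMr ?ltr0n //.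
rewrite -!natrM ltr_nat ler_nat.
have := leq_trunc_div n.-1 k; have := ltn_ceil n.-1 k_gt0; lia.
Qed.

Unset Implicit Arguments.

Theorem theorem6p2 (n k : nat) (hn : (5 <= n)%N) (hk : (2 <= k < n)%N) :
  Dist (PX n k) = 2%N /\
  Num.ceil (n%:R / k%:R : rat) <= (rho (PX n k))%:Z
    <= Num.ceil (n%:R / k%:R : rat) + 1.
Proof.
have [k_ge2 k_lt_n] := andP hk.
have [c dc c0] := seeds_distinguishing hn k_ge2 k_lt_n.
split.
  rewrite /Dist; case: ex_minnP => d /existsP[c' dc'] dmin.
  apply/eqP; rewrite eqn_leq (distinguishing_ge2 hn k_ge2 dc') andbT.
  by apply: dmin; apply/existsP; exists c.
have k_gt0 : (0 < k)%N by apply: ltnW.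
have class_ge (c' : {ffun _ -> 'I_2}) i : distinguishing (PX n k) c' ->
    ((n.-1 %/ k).+1 <= #|color_class c' i|)%N.
  move=> dc'; have le_n := color_class_ge hn k_ge2 i dc'.
  by rewrite ltn_divLR //; apply: leq_trans le_n; rewrite prednK //; lia.
(* The default value of both minima in [rho] must satisfy the lower bound too. *)
have T_ge : ((n.-1 %/ k).+1 <= #|PX_vertex n k|)%N.
  by apply: leq_trans (class_ge c ord0 dc) _; apply: max_card.
rewrite ceil_natdiv //; last by lia.
rewrite -PoszD !lez_nat /rho -!minEnat -!leEnat; apply/andP; split.
  apply/Order.TotalTheory.bigmin_geP; split=> // c' dc'.
  by apply/Order.TotalTheory.bigmin_geP; split=> // i _; apply: class_ge.
apply: (Order.TotalTheory.bigmin_inf c) => //.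
apply: (Order.TotalTheory.bigmin_inf ord0) => //.
by rewrite c0 addn1; exact: card_seeds.
Qed.
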